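(* Let $k\ge 0$ be an integer and $n=48k+14$; all arithmetic is modulo $n$. Define $c_1(r)=r$ for $0\le r\le n-1$. Define $c_2,c_3:\{0,\dots,n-1\}\to\mathbb{Z}_n$ by: for $0\le i\le 12k+3$, $c_2(2i)=6k+1+i(12k+4)$ and $c_3(2i)=6k+2+i(12k+5)$; for $0\le i\le 12k+2$, $c_2(2i+1)=12k+3+i(12k+4)$ and $c_3(2i+1)=24k+8+i(12k+5)$; and for $0\le r\le 24k+6$ and $\alpha=2,3$, $c_\alpha(n-1-r)=n-1-c_\alpha(r)$. For $\alpha=1,2,3$ let ${\cal L}_\alpha=[l_\alpha(r,j)]$ be the $n\times n$ array with $l_\alpha(r,j)\equiv c_\alpha(r)+j\pmod n$, $0\le r,j\le n-1$. Then ${\cal L}_1,{\cal L}_2,{\cal L}_3$ are three (cyclic) mutually nearly orthogonal Latin squares of order $n$, i.e. they are Latin squares and each pair of them is nearly orthogonal.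
   Context: A Latin square of order $n$ is an $n\times n$ array in which each row and each column contains each of the symbols $0,\dots,n-1$ exactly once. For Latin squares $L=[l(i,j)]$ and $M=[m(i,j)]$ of even order $n$ on symbols $\{0,\dots,n-1\}$, their superimposition is the $n\times n$ array $A=[(l(i,j),m(i,j))]$. $L$ and $M$ are nearly orthogonal if in $A$ every ordered pair $(x,y)$ with $0\le x,y\le n-1$, $x\ne y$, occurs at least once, and each ordered pair $(x,x+n/2)$ (second coordinate taken modulo $n$) occurs exactly twice. A set of Latin squares is mutually nearly orthogonal if every two of them are nearly orthogonal. *)

(* Defs.v *)
From mathcomp Require Import all_boot all_algebra.
Set Implicit Arguments.
Unset Strict Implicit.
Unset Printing Implicit Defensive.

Local Open Scope nat_scope.

Definition latin_square (n : nat) (L : 'M['I_n]_n) : Prop :=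
  (forall r x : 'I_n, #|[set j : 'I_n | L r j == x]| = 1) /\
  (forall j x : 'I_n, #|[set r : 'I_n | L r j == x]| = 1).

(* Cells at which the superimposition of [L] and [M] has the entry [(x, y)]. *)
Definition cells (n : nat) (L M : 'M['I_n]_n) (x y : 'I_n) :
    {set 'I_n * 'I_n} :=
  [set p | (L p.1 p.2, M p.1 p.2) == (x, y)].

Definition nearly_orthogonal (n : nat) (L M : 'M['I_n]_n) : Prop :=
  [/\ ~~ odd n,
      forall x y : 'I_n, x != y -> 1 <= #|cells L M x y|
    & forall x y : 'I_n, nat_of_ord y = (x + n./2) %% n ->
        #|cells L M x y| = 2].

Definition mutually_nearly_orthogonal_latin_squares (n t : nat)
    (Ls : t.-tuple 'M['I_n]_n) : Prop :=
  (forall a : 'I_t, latin_square (tnth Ls a)) /\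
  (forall a b : 'I_t, a != b -> nearly_orthogonal (tnth Ls a) (tnth Ls b)).

Definition sq_order (k : nat) : nat := 48 * k + 14.

Lemma sq_order_gt0 (k : nat) : 0 < sq_order k.
Proof. by rewrite /sq_order addnS. Qed.

(* In the first columns below, elements of Z_n are represented by their
   residues in [0, n), so the truncated subtraction [n.-1 - _] is exact. *)

Definition c1 (k r : nat) : nat := r.

(* Top half of the first column, 0 <= r <= n/2 - 1; a row is 2i or 2i + 1
   with i = r./2. *)
Definition c2_top (k r : nat) : nat :=
  let i := r./2 in
  (if odd r then 12 * k + 3 + i * (12 * k + 4)
   else 6 * k + 1 + i * (12 * k + 4)) %% sq_order k.

Definition c3_top (k r : nat) : nat :=
  let i := r./2 in
  (if odd r then 24 * k + 8 + i * (12 * k + 5)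
   else 6 * k + 2 + i * (12 * k + 5)) %% sq_order k.

Definition reflect_column (k : nat) (top : nat -> nat) (r : nat) : nat :=
  let n := sq_order k in
  if r <= 24 * k + 6 then top r else n.-1 - top (n.-1 - r).

Definition c2 (k : nat) : nat -> nat := reflect_column k (c2_top k).

Definition c3 (k : nat) : nat -> nat := reflect_column k (c3_top k).

Definition cyclic_array (k : nat) (c : nat -> nat) :
    'M['I_(sq_order k)]_(sq_order k) :=
  \matrix_(r, j) Ordinal (ltn_pmod (c r + j) (sq_order_gt0 k)).

(* Main.v *)
(* Put h = n/2 = 24k+7.  In a cyclic array a pair (x, y) occurs in the
   superimposition as often as y - x occurs among the row differences of the
   two first columns, and these differences change sign under r -> n-1-r, so
   only the top half of the columns matters.  There, modulo n,
     c2(r) - c1(r) = (6k+1)(r+1),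
     c3(r) - c2(r) = rank23(r),
     c3(r) - c1(r) = -(12k+3) rank13(r),
   where r+1, rank23 and rank13 are bijections onto {1, ..., h} and the
   multipliers are units, so every nonzero residue is d or -d for exactly
   one of these d, and only h = -h is both.  The columns are permutations since modulo n
     c2(r) = 6k+1 + r(6k+2),
     c3(r) = (12k+5) rank23(r) - (6k+3)
   on the top half, and the reflection sends 2c+1 to -(2c+1); the values of c2
   there are odd, so their reflections are even. *)
Require Import Defs.
From mathcomp Require Import all_boot all_algebra.
From mathcomp Require Import zify ring.

(** * Congruence as integer divisibility *)

Lemma eq_modn_dvdz (d a b : nat) :
  (a == b %[mod d]) = (d%:Z %| (a%:Z - b%:Z)%R)%Z.
Proof. by rewrite -eqz_mod_dvd !modz_nat. Qed.

Lemma eq_modnD_dvdz (d a b c : nat) :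
  (a + b == c %[mod d]) = (d%:Z %| (a%:Z + b%:Z - c%:Z)%R)%Z.
Proof. by rewrite eq_modn_dvdz PoszD. Qed.

Lemma dvdz_small_eq0 (n x : int) :
  (n %| x)%Z -> (`|x| < n)%R -> x = 0%R.
Proof.
rewrite dvdzE => n_x lt_x_n; apply/eqP; rewrite -absz_eq0; apply: contraTT n_x.
by rewrite -lt0n => x_gt0; rewrite gtnNdvd //; lia.
Qed.

(** * Latin property and superimposition of cyclic arrays *)

Lemma card_inj_fiber (T : finType) (f : T -> T) (x : T) :
  injective f -> #|[set y | f y == x]| = 1.
Proof.
move=> f_inj; rewrite -(cards1 x) -(card_preimset [set x] f_inj).
by congr #|pred_of_set _|; apply/setP=> y; rewrite !inE.
Qed.

Lemma cyclic_latin_square (k : nat) (c : nat -> nat) :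
  (forall r s, r < sq_order k -> s < sq_order k ->
     (sq_order k %| ((c r)%:Z - (c s)%:Z)%R)%Z -> r = s) ->
  latin_square (cyclic_array k c).
Proof.
move=> c_inj; split=> [r x|j x]; apply: card_inj_fiber => i i'.
  rewrite !mxE => /(congr1 val)/eqP /=.
  by rewrite eqn_modDl !modn_small // => /eqP/val_inj.
rewrite !mxE => /(congr1 val)/eqP /=; rewrite eqn_modDr eq_modn_dvdz => n_dvd.
by apply: val_inj; apply: c_inj n_dvd; exact: ltn_ord.
Qed.

Lemma card_cells_cyclic (k : nat) (c c' : nat -> nat) (x y : 'I_(sq_order k)) :
  #|cells (cyclic_array k c) (cyclic_array k c') x y| =
  #|[set r : 'I_(sq_order k) | (sq_order k %|
       ((c' r)%:Z - (c r)%:Z - (y%:Z - x%:Z))%R)%Z]|.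
Proof.
have cellP (p : 'I_(sq_order k) * 'I_(sq_order k)) :
    p \in cells (cyclic_array k c) (cyclic_array k c') x y ->
    (sq_order k %| ((c p.1)%:Z + p.2%:Z - x%:Z)%R)%Z /\
    (sq_order k %| ((c' p.1)%:Z + p.2%:Z - y%:Z)%R)%Z.
  rewrite inE xpair_eqE !mxE -!val_eqE /=.
  by rewrite -[X in _ == X](modn_small (ltn_ord x))
    -[X in _ && (_ == X)](modn_small (ltn_ord y)) !eq_modnD_dvdz => /andP.
(* Within a row, the first entry [x] determines the column, so cells can be counted by their
   rows. *)
rewrite -(@card_in_imset _ _ fst); last first.
  move=> [r j] [r' j'] /cellP[/= /dvdzP[q eq_q] _] /cellP[/= /dvdzP[q' eq_q'] _].
  move=> /= eq_r; rewrite -{}eq_r in eq_q' *; congr pair; apply/val_inj/eqP.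
  rewrite /= -(modn_small (ltn_ord j)) -(modn_small (ltn_ord j')) eq_modn_dvdz.
  apply/dvdzP; exists (q - q')%R; lia.
congr #|pred_of_set _|; apply/setP=> r; rewrite inE; apply/imsetP/idP.
  case=> -[r' j] /cellP[/= /dvdzP[q eq_q] /dvdzP[q' eq_q']] ->.
  by apply/dvdzP; exists (q' - q)%R; lia.
move=> /dvdzP[q eq_q].
have n_gt0 := sq_order_gt0 k.
(* The column is the residue of [x - c r], taken in the integers because the difference may be
   negative. *)
have zE := divz_eq (x%:Z - (c r)%:Z)%R (sq_order k).
have: (0 <= (x%:Z - (c r)%:Z)%R %% sq_order k < sq_order k)%Z%R.
  by rewrite modz_ge0 ?ltz_pmod //; lia.
move: (_ %/ _)%Z (_ %% _)%Z zE => d [z|//] zE lt_z.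
exists (r, Ordinal lt_z) => //.
rewrite inE xpair_eqE !mxE -!val_eqE /=.
rewrite -[X in _ == X](modn_small (ltn_ord x)).
rewrite -[X in _ && (_ == X)](modn_small (ltn_ord y)) !eq_modnD_dvdz.
by apply/andP; split; apply/dvdzP; [exists (- d)%R | exists (q - d)%R]; lia.
Qed.

(** * Columns symmetric under reflection *)

Definition reflected (k : nat) (c : nat -> nat) : Prop :=
  forall r, r < 24 * k + 7 ->
    c r < sq_order k /\ c ((sq_order k).-1 - r) = (sq_order k).-1 - c r.

(** Reflection sends a value [v] to [-1 - v] modulo [n], so rows in opposite halves collide exactly
    when two top values sum to [-1]; the last hypothesis on [c] excludes this. *)
Lemma reflected_inj (k : nat) (c : nat -> nat) :
    reflected k c ->
    (forall r s, r < 24 * k + 7 -> s < 24 * k + 7 ->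
       (sq_order k %| ((c r)%:Z - (c s)%:Z)%R)%Z -> r = s) ->
    (forall r s, r < 24 * k + 7 -> s < 24 * k + 7 ->
       ~~ (sq_order k %| ((c r)%:Z + (c s)%:Z + 1)%R)%Z) ->
  forall r s, r < sq_order k -> s < sq_order k ->
    (sq_order k %| ((c r)%:Z - (c s)%:Z)%R)%Z -> r = s.
Proof.
rewrite /reflected; have : sq_order k = 2 * (24 * k + 7) by rewrite /sq_order; lia.
move: (sq_order k) (24 * k + 7) => n h nE c_refl c_inj c_sum r s r_lt s_lt.
have upper t : t < n -> h <= t ->
    [/\ n.-1 - t < h, c (n.-1 - t) < n & c t = n.-1 - c (n.-1 - t)].
  move=> t_lt t_ge; have lt_h : n.-1 - t < h by lia.
  by have [lt_n] := c_refl _ lt_h; rewrite subKn //; lia.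
case: (ltnP r h) => r_h; case: (ltnP s h) => s_h.
- exact: c_inj.
- have [s'_lt c_lt ->] := upper s s_lt s_h => /dvdzP[q eq_q].
  case/negP: (c_sum _ _ r_h s'_lt); apply/dvdzP; exists (q + 1)%R; lia.
- have [r'_lt c_lt ->] := upper r r_lt r_h => /dvdzP[q eq_q].
  case/negP: (c_sum _ _ r'_lt s_h); apply/dvdzP; exists (1 - q)%R; lia.
have [r'_lt c_lt ->] := upper r r_lt r_h; have [s'_lt c'_lt ->] := upper s s_lt s_h.
move=> /dvdzP[q eq_q]; have: n.-1 - r = n.-1 - s; last lia.
by apply: c_inj => //; apply/dvdzP; exists (- q)%R; lia.
Qed.

(** * Counting signed multiples of a unit *)

Lemma inj_onto_initial (h : nat) (p : nat -> nat) (m : nat) :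
    (forall r, r < h -> 0 < p r <= h) ->
    (forall r s, r < h -> s < h -> p r = p s -> r = s) ->
  0 < m <= h -> exists2 r, r < h & p r = m.
Proof.
move=> p_bound p_inj m_bound.
have uniq_p : uniq [seq p r | r <- iota 0 h].
  rewrite map_inj_in_uniq ?iota_uniq // => r s.
  by rewrite !mem_iota /= => r_lt s_lt; apply: p_inj.
have sub_p : {subset [seq p r | r <- iota 0 h] <= iota 1 h}.
  move=> _ /mapP[r + ->]; rewrite !mem_iota add0n /= => /p_bound; lia.
have [|_ /(_ m)] := uniq_min_size uniq_p sub_p; first by rewrite size_map !size_iota.
rewrite mem_iota add1n ltnS m_bound => /mapP[r]; rewrite mem_iota add0n /=.
by exists r.
Qed.

(** A nonzero residue is [e * w] with [0 < w < n]: if [w <= h] it is met in the top half, otherwise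
    [n - w] serves in the bottom half. As [e] is odd, [e * h] and [- e * h] are both [h] modulo [n],
    which is thus met once in each half. *)
Lemma card_signed_multiples (n h : nat) (D : nat -> int) (e : int)
    (p : nat -> nat) :
    n = 2 * h -> 0 < h -> coprimez e n ->
    (forall r, r < h -> 0 < p r <= h) ->
    (forall r s, r < h -> s < h -> p r = p s -> r = s) ->
    (forall r, r < h -> (n %| (D r - e * (p r)%:Z)%R)%Z) ->
    (forall r, r < h -> (n %| (D (n.-1 - r)%N + e * (p r)%:Z)%R)%Z) ->
  (forall t : int, ~~ (n %| t)%Z ->
     0 < #|[set r : 'I_n | (n %| (D r - t)%R)%Z]|) /\
  (forall t : int, (n %| (t - h%:Z)%R)%Z ->
     #|[set r : 'I_n | (n %| (D r - t)%R)%Z]| = 2).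
Proof.
move=> nE h_gt0 e_cop p_bound p_inj D_lo D_hi.
have p_onto m := inj_onto_initial h p m p_bound p_inj.
have [[u v] /= euv] := coprimezP _ _ e_cop.
split=> [t t_neq0|t t_h].
  have n_gt0 : (0 < n%:Z)%R by lia.
  have w_ge0 : (0 <= (u * t)%R %% n)%Z%R by rewrite modz_ge0 //; lia.
  have w_lt : ((u * t)%R %% n < n)%Z%R by rewrite ltz_pmod.
  have wE := divz_eq (u * t)%R n.
  move: (_ %/ _)%Z (_ %% _)%Z wE w_ge0 w_lt => a w ut w_ge0 w_lt.
  (* The Bezout coefficient [u] inverts [e] modulo [n], so [w] solves [t = e * w] modulo [n]. *)
  have [d tE] : exists d : int, (t = e * w + d * n)%R.
    exists (v * t + e * a)%R.
    have -> : (w = u * t - a * n)%R by rewrite ut; ring.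
    by rewrite -[LHS]GRing.mul1r -euv; ring.
  have w_neq0 : w <> 0%R.
    by move=> w0; case/negP: t_neq0; apply/dvdzP; exists d; rewrite tE w0; ring.
  case: w tE w_neq0 w_ge0 w_lt {ut} => // w tE w_neq0 _ w_lt.
  have [w_le|w_gt] := leqP w h.
    have [|r r_lt pr] := p_onto w; first lia.
    have r_n : r < n by lia.
    apply/card_gt0P; exists (Ordinal r_n); rewrite inE /=.
    case/dvdzP: (D_lo r r_lt) => q eq_q; apply/dvdzP; exists (q - d)%R.
    by move: eq_q; rewrite pr tE; lia.
  have [|r r_lt pr] := p_onto (n - w); first lia.
  have r_n : n.-1 - r < n by lia.
  apply/card_gt0P; exists (Ordinal r_n); rewrite inE /=.
  case/dvdzP: (D_hi r r_lt) => q eq_q; apply/dvdzP; exists (q - d - e)%R.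
  move: eq_q; rewrite pr tE; have -> : Posz (n - w) = (n%:Z - w%:Z)%R by lia.
  lia.
(* An even [e] would make both terms of the Bezout identity even. *)
have [m em] : exists m : int, e = (2 * m + 1)%R.
  have [m [em|em]] : exists m : int, e = (2 * m)%R \/ e = (2 * m + 1)%R.
  - by exists (e %/ 2)%Z; lia.
  - by move: euv; rewrite em nE PoszM; lia.
  by exists m.
have {t_h} [z tE] : exists z : int, t = (h%:Z + z * n)%R.
  by case/dvdzP: t_h => z tE; exists z; lia.
have nZ : Posz n = (2 * h%:Z)%R by rewrite nE PoszM.
have [|r0 r0_lt pr0] := p_onto h; first lia.
have r0_n : r0 < n by lia.
have r0'_n : n.-1 - r0 < n by lia.
(* Here [p s - h] is smaller than [n] in absolute value, so divisibility forces [p s = h]. *)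
have eq_r0 s : s < h -> (n %| (e * ((p s)%:Z - h%:Z))%R)%Z -> s = r0.
  move=> s_lt; rewrite Gauss_dvdzr 1?coprimez_sym // => /dvdz_small_eq0 ps.
  have ps_bound := p_bound s s_lt.
  by apply: p_inj => //; rewrite pr0; apply/eqP; move: ps; lia.
have D_loE s : s < h -> (n %| (D s - t)%R)%Z = (s == r0).
  move=> s_lt; case/dvdzP: (D_lo s s_lt) => q eq_q; apply/idP/eqP.
    case/dvdzP=> q' eq_q'; apply: eq_r0 => //.
    apply/dvdzP; exists (q' - q + z - m)%R; rewrite em tE nZ in eq_q eq_q' *; lia.
  move=> s_r0; move: eq_q; rewrite {}s_r0 pr0 => eq_q.
  apply/dvdzP; exists (q - z + m)%R; rewrite em tE nZ in eq_q *; lia.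
have D_hiE s : s < h -> (n %| (D (n.-1 - s)%N - t)%R)%Z = (s == r0).
  move=> s_lt; case/dvdzP: (D_hi s s_lt) => q eq_q; apply/idP/eqP.
    case/dvdzP=> q' eq_q'; apply: eq_r0 => //.
    apply/dvdzP; exists (q - q' - z - m - 1)%R; rewrite em tE nZ in eq_q eq_q' *; lia.
  move=> s_r0; move: eq_q; rewrite {}s_r0 pr0 => eq_q.
  apply/dvdzP; exists (q - z - m - 1)%R; rewrite em tE nZ in eq_q *; lia.
have -> : [set r : 'I_n | (n %| (D r - t)%R)%Z] = [set Ordinal r0_n; Ordinal r0'_n].
  apply/setP=> r; rewrite !inE -!val_eqE /=; have r_n := ltn_ord r.
  have [r_h|h_r] := ltnP r h; first by rewrite D_loE //; lia.
  have -> : nat_of_ord r = n.-1 - (n.-1 - r) by lia.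
  by rewrite D_hiE; lia.
by rewrite cards2 -val_eqE /=; have -> : (r0 != n.-1 - r0) by lia.
Qed.

Lemma cyclic_nearly_orthogonal (k : nat) (c c' : nat -> nat) (e : int)
    (p : nat -> nat) :
    reflected k c -> reflected k c' -> coprimez e (sq_order k) ->
    (forall r, r < 24 * k + 7 -> 0 < p r <= 24 * k + 7) ->
    (forall r s, r < 24 * k + 7 -> s < 24 * k + 7 -> p r = p s -> r = s) ->
    (forall r, r < 24 * k + 7 ->
       (sq_order k %| ((c' r)%:Z - (c r)%:Z - e * (p r)%:Z)%R)%Z) ->
  nearly_orthogonal (cyclic_array k c) (cyclic_array k c').
Proof.
move=> c_refl c'_refl e_cop p_bound p_inj diff_p.
have nE : sq_order k = 2 * (24 * k + 7) by rewrite /sq_order; lia.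
have halfE : (sq_order k)./2 = 24 * k + 7 by rewrite nE mul2n doubleK.
have [|r r_lt|rows_gt0 rows_half] := card_signed_multiples (sq_order k) (24 * k + 7)
  (fun r => (c' r)%:Z - (c r)%:Z)%R e p nE _ e_cop p_bound p_inj diff_p.
- by rewrite addn_gt0 orbT.
- have [c_lt ->] := c_refl r r_lt; have [c'_lt ->] := c'_refl r r_lt.
  move: (sq_order k) c_lt c'_lt (diff_p r r_lt) => n c_lt c'_lt /dvdzP[q eq_q].
  by apply/dvdzP; exists (- q)%R; lia.
split=> [|x y neq_xy|x y eq_y]; rewrite ?card_cells_cyclic.
- by rewrite nE oddM.
- by apply: rows_gt0; rewrite -eq_modn_dvdz !modn_small // eq_sym.
apply: rows_half; have : y == x + (24 * k + 7) %[mod sq_order k].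
  by rewrite eq_y modn_mod halfE.
rewrite eq_modn_dvdz => /dvdzP[q eq_q]; apply/dvdzP; exists q.
by rewrite -eq_q PoszD; ring.
Qed.

Lemma nearly_orthogonal_sym (n : nat) (L M : 'M['I_n]_n) :
  nearly_orthogonal L M -> nearly_orthogonal M L.
Proof.
have cellsC x y : cells M L x y = cells L M y x.
  by apply/setP=> q; rewrite !inE !xpair_eqE andbC.
case=> n_even cells_gt0 cells_half; split=> // x y.
  by rewrite cellsC eq_sym; apply: cells_gt0.
(* The shift by [n./2] is an involution modulo the even [n]. *)
rewrite cellsC => yE; apply: cells_half; rewrite yE modnDml -addnA addnn.
by rewrite even_halfK // modnDr modn_small.
Qed.

(** * The three columns modulo n *)

Lemma c1_reflected (k : nat) : reflected k (c1 k).
Proof. by move=> r r_lt; rewrite /c1 /sq_order; split; lia. Qed.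

Lemma reflect_column_reflected (k : nat) (top : nat -> nat) :
  (forall r, top r < sq_order k) -> reflected k (reflect_column k top).
Proof.
move=> top_lt r r_lt; rewrite /reflect_column.
have -> : r <= 24 * k + 6 by lia.
have -> : ((sq_order k).-1 - r <= 24 * k + 6) = false by rewrite /sq_order; lia.
by rewrite top_lt subKn //; rewrite /sq_order; lia.
Qed.

Lemma c2_reflected (k : nat) : reflected k (c2 k).
Proof.
by apply: reflect_column_reflected => r; rewrite ltn_pmod ?sq_order_gt0.
Qed.

Lemma c3_reflected (k : nat) : reflected k (c3 k).
Proof.
by apply: reflect_column_reflected => r; rewrite ltn_pmod ?sq_order_gt0.
Qed.

(** The odd rows start [6k+2] above the even ones, half of the step [12k+4], so both parities
    interleave into one progression. *)
Lemma c2_cong (k r : nat) : r < 24 * k + 7 ->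
  (sq_order k %| ((c2 k r)%:Z - (6 * k + 1 + r * (6 * k + 2))%N%:Z)%R)%Z.
Proof.
move=> r_lt; rewrite /c2 /reflect_column ifT; last by lia.
rewrite -eq_modn_dvdz modn_mod; apply/eqP; congr (_ %% _).
clear r_lt; move: (odd r) r./2 (odd_double_half r) => b i <-.
by case: b; lia.
Qed.

(** Also the position of [c3 k r] in a progression of step [12k+5]: the [12k+4] even rows come first
    and the odd rows continue it. *)
Definition rank23 (k r : nat) : nat :=
  if odd r then 12 * k + 5 + r./2 else r./2.+1.

(** Two rows further down, [c3 - c1] gains [12k+5-2 = 12k+3]; with the multiplier [-(12k+3)] the
    rank drops by one. *)
Definition rank13 (k r : nat) : nat :=
  if odd r then 24 * k + 7 - r./2 else 12 * k + 4 - r./2.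

Lemma rank23_bound (k r : nat) : r < 24 * k + 7 -> 0 < rank23 k r <= 24 * k + 7.
Proof. by rewrite /rank23; case: ifP; lia. Qed.

Lemma rank23_inj (k r s : nat) :
  r < 24 * k + 7 -> s < 24 * k + 7 -> rank23 k r = rank23 k s -> r = s.
Proof. by rewrite /rank23; case: ifP; case: ifP; lia. Qed.

Lemma rank13_bound (k r : nat) : r < 24 * k + 7 -> 0 < rank13 k r <= 24 * k + 7.
Proof. by rewrite /rank13; case: ifP; lia. Qed.

Lemma rank13_inj (k r s : nat) :
  r < 24 * k + 7 -> s < 24 * k + 7 -> rank13 k r = rank13 k s -> r = s.
Proof. by rewrite /rank13; case: ifP; case: ifP; lia. Qed.

Lemma c3_cong (k r : nat) : r < 24 * k + 7 ->
  (sq_order k %| ((c3 k r)%:Z -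
     ((12 * k + 5)%N%:Z * (rank23 k r)%:Z - (6 * k + 3)%N%:Z))%R)%Z.
Proof.
move=> r_lt; rewrite /c3 /reflect_column ifT; last by lia.
set v := c3_top k r.
have [q vE] : exists q : int, Posz v = ((if odd r then 24 * k + 8 + r./2 * (12 * k + 5)
   else 6 * k + 2 + r./2 * (12 * k + 5))%N%:Z + q * sq_order k)%R.
  exists (- Posz ((if odd r then 24 * k + 8 + r./2 * (12 * k + 5)
     else 6 * k + 2 + r./2 * (12 * k + 5)) %/ sq_order k))%R.
  rewrite /v /c3_top; move: (sq_order k) (if _ then _ else _) => n m.
  by have := divn_eq m n; lia.
rewrite vE /rank23; apply/dvdzP; case: (odd r).
  (* At the first odd row, [(12k+5)^2 - (6k+3) = 24k+8 + (3k+1)n]. *)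
  by exists (q - (3 * k%:Z + 1))%R; rewrite /sq_order; lia.
by exists q; rewrite /sq_order; lia.
Qed.

(** * Coprimality by explicit Bezout identities *)

Lemma coprimez_6k1 (k : nat) : coprimez (6 * k + 1)%N (sq_order k).
Proof.
apply/coprimezP; exists (8 * k%:Z + 1, - k%:Z)%R.
by rewrite /sq_order /=; lia.
Qed.

Lemma coprimez_12k3 (k : nat) : coprimez (- (12 * k + 3)%N%:Z)%R (sq_order k).
Proof.
apply/coprimezP; exists (- (24 * k%:Z + 5), - (6 * k%:Z + 1))%R.
by rewrite /sq_order /=; lia.
Qed.

Lemma coprimez_12k5 (k : nat) : coprimez (12 * k + 5)%N (sq_order k).
Proof.
apply/coprimezP; exists (8 * k%:Z + 3, - (2 * k%:Z + 1))%R.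
by rewrite /sq_order /=; lia.
Qed.

(** The step [6k+2] of [c2] is not a unit modulo the even [n]; its half is one modulo [n/2]. *)
Lemma coprimez_3k1 (k : nat) : coprimez (24 * k + 7)%N (3 * k + 1)%N.
Proof.
by apply/coprimezP; exists (-1, 8)%R => /=; lia.
Qed.

(** * Near orthogonality of the three pairs *)

Lemma c1_c2_nearly_orthogonal (k : nat) :
  nearly_orthogonal (cyclic_array k (c1 k)) (cyclic_array k (c2 k)).
Proof.
apply: (@cyclic_nearly_orthogonal k _ _ (6 * k + 1)%N succn).
- exact: c1_reflected.
- exact: c2_reflected.
- exact: coprimez_6k1.
- by move=> r; lia.
- by move=> r s _ _ [].
move=> r r_lt; case/dvdzP: (c2_cong _ _ r_lt) => q eq_q.
by apply/dvdzP; exists q; rewrite -eq_q /c1; lia.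
Qed.

Lemma c2_c3_nearly_orthogonal (k : nat) :
  nearly_orthogonal (cyclic_array k (c2 k)) (cyclic_array k (c3 k)).
Proof.
apply: (@cyclic_nearly_orthogonal k _ _ 1%R (rank23 k)).
- exact: c2_reflected.
- exact: c3_reflected.
- by rewrite /coprimez gcd1z.
- exact: rank23_bound.
- exact: rank23_inj.
move=> r r_lt; case/dvdzP: (c2_cong _ _ r_lt) => q eq_q.
case/dvdzP: (c3_cong _ _ r_lt) => q' eq_q'.
have rE : r * (6 * k + 2) = (odd r + r./2.*2) * (6 * k + 2).
  by rewrite odd_double_half.
apply/dvdzP; move: eq_q eq_q'; rewrite rE /rank23; case: (odd r) => eq_q eq_q'.
  by exists (q' - q + (3 * k%:Z + 1))%R; rewrite /sq_order in eq_q eq_q' *; lia.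
by exists (q' - q)%R; rewrite /sq_order in eq_q eq_q' *; lia.
Qed.

Lemma c1_c3_nearly_orthogonal (k : nat) :
  nearly_orthogonal (cyclic_array k (c1 k)) (cyclic_array k (c3 k)).
Proof.
apply: (@cyclic_nearly_orthogonal k _ _ (- (12 * k + 3)%N%:Z)%R (rank13 k)).
- exact: c1_reflected.
- exact: c3_reflected.
- exact: coprimez_12k3.
- exact: rank13_bound.
- exact: rank13_inj.
move=> r r_lt; case/dvdzP: (c3_cong _ _ r_lt) => q eq_q.
apply/dvdzP; move: eq_q; rewrite /rank23 /rank13 /c1.
have := odd_double_half r; case: (odd r) => rE eq_q.
  have -> : Posz (24 * k + 7 - r./2) = (24 * k%:Z + 7 - (r./2)%:Z)%R by lia.
  (* The multiple is [3k+1] from the start of the odd rows in [c3], plus [6k+2] from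
     [(24k+7)(12k+4) = (6k+2)n]. *)
  by exists (q + 9 * k%:Z + 3)%R; rewrite /sq_order in eq_q *; lia.
have -> : Posz (12 * k + 4 - r./2) = (12 * k%:Z + 4 - (r./2)%:Z)%R by lia.
by exists (q + 3 * k%:Z + 1)%R; rewrite /sq_order in eq_q *; lia.
Qed.

(** * Latin property of the three squares *)

Lemma c1_latin (k : nat) : latin_square (cyclic_array k (c1 k)).
Proof.
apply: cyclic_latin_square => r s r_lt s_lt /dvdz_small_eq0 eq_rs.
by apply/eqP; move: eq_rs; rewrite /c1; lia.
Qed.

Lemma c2_latin (k : nat) : latin_square (cyclic_array k (c2 k)).
Proof.
apply/cyclic_latin_square/reflected_inj; first exact: c2_reflected.
- move=> r s r_lt s_lt /dvdzP[q eq_q].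
  case/dvdzP: (c2_cong _ _ r_lt) => q1 eq_q1.
  case/dvdzP: (c2_cong _ _ s_lt) => q2 eq_q2.
  have : ((24 * k + 7)%N %| (r%:Z - s%:Z)%R)%Z.
    rewrite -(Gauss_dvdzr _ (coprimez_3k1 k)); apply/dvdzP.
    by exists (q - q1 + q2)%R; rewrite /sq_order in eq_q eq_q1 eq_q2; lia.
  by move=> /dvdz_small_eq0; lia.
(* Both values are odd, so their sum plus one is odd, while [n] is even. *)
move=> r s r_lt s_lt; apply/negP => /dvdzP[q eq_q].
case/dvdzP: (c2_cong _ _ r_lt) => q1 eq_q1.
case/dvdzP: (c2_cong _ _ s_lt) => q2 eq_q2.
by rewrite /sq_order in eq_q eq_q1 eq_q2; lia.
Qed.

Lemma c3_latin (k : nat) : latin_square (cyclic_array k (c3 k)).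
Proof.
have nE : sq_order k = 48 * k + 14 by [].
apply/cyclic_latin_square/reflected_inj; first exact: c3_reflected.
- move=> r s r_lt s_lt /dvdzP[q eq_q].
  case/dvdzP: (c3_cong _ _ r_lt) => q1 eq_q1.
  case/dvdzP: (c3_cong _ _ s_lt) => q2 eq_q2.
  have : (sq_order k %| ((rank23 k r)%:Z - (rank23 k s)%:Z)%R)%Z.
    rewrite -(@Gauss_dvdzr _ (12 * k + 5)%N) 1?coprimez_sym ?coprimez_12k5 //.
    by apply/dvdzP; exists (q - q1 + q2)%R; lia.
  have := rank23_bound _ _ r_lt; have := rank23_bound _ _ s_lt.
  move=> s_bd r_bd /dvdz_small_eq0 eq_rank.
  by apply: (@rank23_inj k) => //; lia.
move=> r s r_lt s_lt; apply/negP => /dvdzP[q eq_q].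
case/dvdzP: (c3_cong _ _ r_lt) => q1 eq_q1.
case/dvdzP: (c3_cong _ _ s_lt) => q2 eq_q2.
(* The constant [1 - 2(6k+3)] equals [-(12k+5)], so the unit factors out; the remaining factor lies
   between [1] and [n-1]. *)
have : (sq_order k %| ((rank23 k r)%:Z + (rank23 k s)%:Z - 1)%R)%Z.
  rewrite -(@Gauss_dvdzr _ (12 * k + 5)%N) 1?coprimez_sym ?coprimez_12k5 //.
  by apply/dvdzP; exists (q - q1 - q2)%R; lia.
have := rank23_bound _ _ r_lt; have := rank23_bound _ _ s_lt.
by move=> s_bd r_bd /dvdz_small_eq0; lia.
Qed.

Theorem theorem3 (k : nat) :
  mutually_nearly_orthogonal_latin_squares
    [tuple cyclic_array k (c1 k); cyclic_array k (c2 k); cyclic_array k (c3 k)].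
Proof.
have o12 := c1_c2_nearly_orthogonal k; have o13 := c1_c3_nearly_orthogonal k.
have o23 := c2_c3_nearly_orthogonal k.
split.
  by case=> [[|[|[|]]]] // ?; rewrite (tnth_nth (cyclic_array k (c1 k))) /=;
    [exact: c1_latin | exact: c2_latin | exact: c3_latin].
by case=> [[|[|[|]]]] // ? [[|[|[|]]]] // ? _;
  rewrite !(tnth_nth (cyclic_array k (c1 k))) /=; try (by []);
  apply: nearly_orthogonal_sym.
Qed.
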